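(* Let $k$ and $m$ be positive integers. Every $k$-connected bipartite graph $G$ with minimum degree $\delta(G)\geq k+\lceil\frac{m+1}{2}\rceil$ contains a path $P$ of order $m$ such that $\kappa(G-V(P))\geq k$.
   Context: All graphs are finite, simple and undirected. The connectivity $\kappa(G)$ of a graph $G$ is the minimum size of a vertex set $S$ such that $G-S$ is disconnected or has only one vertex; $G$ is $k$-connected if $\kappa(G)\geq k$. The order of a path is its number of vertices. *)

(* Defs.v *)
From mathcomp Require Import all_boot.
Set Implicit Arguments.
Unset Strict Implicit.
Unset Printing Implicit Defensive.

(* A graph on the vertex set T is a symmetric irreflexive relation e : rel T; *)
(* its subgraph induced by W : {set T} is represented by the pair (e, W).     *)

Section Graphs.
Variables (T : finType) (e : rel T).
Implicit Types (W S : {set T}) (p : seq T).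

Definition induced W : rel T := [rel x y | [&& x \in W, y \in W & e x y]].

Definition disconnected W : bool :=
  [exists x in W, exists y in W, ~~ connect (induced W) x y].

Definition separator W S : bool :=
  (S \subset W) && (disconnected (W :\: S) || (#|W :\: S| == 1)).

(* The default value #|W| only matters for the null graph, giving 0: if W is  *)
(* nonempty, removing all but one of its vertices is a separator of size      *)
(* #|W| - 1.                                                                  *)
Definition connectivity W : nat :=
  \big[minn/#|W|]_(S : {set T} | separator W S) #|S|.

Definition degree (x : T) : nat := #|[set y | e x y]|.

(* The default value #|T| exceeds every degree, so it only matters when T is  *)
(* empty.                                                                     *)
Definition min_degree : nat := \big[minn/#|T|]_(x : T) degree x.

Definition bipartite : Prop :=
  exists A : {set T}, forall x y : T, e x y -> (x \in A) != (y \in A).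

(* [sorted e p] says that consecutive entries of p are adjacent.              *)
Definition graph_path p : bool := uniq p && sorted e p.

End Graphs.

Definition k_connected (T : finType) (e : rel T) (k : nat) : Prop :=
  k <= connectivity e [set: T].

(* Main.v *)
(* Grow a path P while G - P stays k-connected. A path contains at most half  *)
(* (rounded up) of its vertices in the neighbourhood of any vertex, so as     *)
(* long as P has fewer than m vertices, G - P has minimum degree at least     *)
(* k + 1. Call a fragment of G - P a set F with k boundary vertices that does *)
(* not reach all of G - P. If there is none, any neighbour of the end of P    *)
(* can be added. Otherwise truncate P to its last vertex adjacent to F, which *)
(* preserves both k-connectivity and the boundary of F, and choose F minimal: *)
(* by uncrossing, a neighbour x of the end of P in F can be added. The rest   *)
(* F - x is then a smaller fragment adjacent to the new end x, so iterating   *)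
(* never gets stuck.                                                          *)

Require Import Defs.
From mathcomp Require Import all_boot all_order.
From mathcomp Require Import zify.
Set Implicit Arguments.
Unset Strict Implicit.
Unset Printing Implicit Defensive.

(** Two facts carry the uncrossing. Vertex boundaries are submodular ([boundaryIU]), so fragments
    that cross suitably intersect in a fragment ([fragmentI]). In a triangle-free graph of minimum
    degree above [k] a fragment has more than [k] vertices ([fragment_large]), too many to lie in a
    boundary of size [k]. Hence any vertex of a minimal fragment can be deleted
    ([kconn_minimal_fragment]). In [fragment_extends] the size of the current fragment decreases at
    every round, even when truncation shortens the path. *)

Lemma leq_bigminP (I : finType) (P : pred I) (F : I -> nat) d n :
  reflect (n <= d /\ forall i, P i -> n <= F i)
          (n <= \big[minn/d]_(i | P i) F i).
Proof.
rewrite -Order.NatOrder.minEnat.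
exact: (@Order.TotalTheory.bigmin_geP _ nat I d n P F).
Qed.

(** * Boundaries and fragments *)

Section Fragments.
Variables (T : finType) (e : rel T).
Hypothesis e_sym : symmetric e.
Implicit Types (A B F W : {set T}) (x y z : T) (p : seq T) (k : nat).

Definition boundary W F := [set y in W :\: F | [exists x in F, e x y]].

Definition rest W F := W :\: (F :|: boundary W F).

Definition deg_in W x := #|[set y in W | e x y]|.

Definition isolated W F := [&& F \subset W, F != set0 & rest W F != set0].

(** Only separations with two nonempty sides count, so complete graphs qualify for every [k]; a
    degree bound later handles separators that leave one vertex. *)
Definition kconn k W := forall F, isolated W F -> k <= #|boundary W F|.

(** Under [kconn k W] the bound is an equality. *)
Definition fragment k W F := isolated W F && (#|boundary W F| <= k).

Lemma boundaryP W F y :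
  reflect [/\ y \in W, y \notin F & exists2 x, x \in F & e x y]
          (y \in boundary W F).
Proof.
rewrite !inE; apply: (iffP andP) => [[/andP[yF yW] /existsP[x /andP[xF exy]]]|].
  by split=> //; exists x.
move=> [yW yF [x xF exy]]; rewrite yF yW; split=> //.
by apply/existsP; exists x; rewrite xF.
Qed.

Lemma restP W F y :
  reflect [/\ y \in W, y \notin F & y \notin boundary W F] (y \in rest W F).
Proof. by rewrite in_setD in_setU negb_or andbC; exact: and3P. Qed.

Lemma isolatedP W F :
  reflect [/\ F \subset W, exists x, x \in F & exists x, x \in rest W F]
          (isolated W F).
Proof.
apply: (iffP and3P) => -[FW F0 R0]; split=> //; try exact/set0Pn.
Qed.

Lemma nbr_closed W F x y :
  x \in F -> y \in W -> e x y -> y \in F :|: boundary W F.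
Proof.
move=> xF yW exy; rewrite in_setU; case: (boolP (y \in F)) => //= yF.
by apply/boundaryP; split=> //; exists x.
Qed.

Lemma boundary_rest W F : boundary W (rest W F) \subset boundary W F.
Proof.
apply/subsetP => y /boundaryP[yW yR [x /restP[xW xF xN] exy]].
case: (boolP (y \in F)) => [yF|yF].
  by case/negP: xN; apply/boundaryP; split=> //; exists y; rewrite // e_sym.
by apply: contraNT yR => yN; apply/restP.
Qed.

Lemma sub_rest_rest W F : F \subset W -> F \subset rest W (rest W F).
Proof.
move=> FW; apply/subsetP => x xF; apply/restP; split; first exact: (subsetP FW).
  by apply/negP => /restP[_]; rewrite xF.
by apply/negP => /(subsetP (boundary_rest W F)) /boundaryP[_]; rewrite xF.
Qed.

Lemma fragment_rest k W F : fragment k W F -> fragment k W (rest W F).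
Proof.
move=> /andP[/isolatedP[FW [x xF] R0] Nk]; apply/andP; split.
  apply/isolatedP; split=> //; first exact: subsetDl.
  by exists x; apply: (subsetP (sub_rest_rest FW)).
exact: leq_trans (subset_leq_card (boundary_rest W F)) Nk.
Qed.

(** * Comparison with connectivity *)

Lemma connectivity_kconn k W : k <= connectivity e W -> kconn k W.
Proof.
move=> /leq_bigminP[_ kW] F /isolatedP[FW [x xF] [z /restP[zW zF zN]]].
apply: kW; apply/andP; split.
  by apply/subsetP => y /boundaryP[].
apply/orP; left; apply/existsP; exists x; rewrite in_setD (subsetP FW) // andbT.
have -> /= : x \notin boundary W F by apply/negP => /boundaryP[_]; rewrite xF.
apply/existsP; exists z; rewrite in_setD zN zW /=.
apply/negP => cxz; case/negP: zF.
have <- // : (x \in F) = (z \in F).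
apply: closed_connect cxz => a b /and3P[]; rewrite !in_setD.
move=> /andP[aN aW] /andP[bN bW] eab; apply/idP/idP => [aF|bF].
  by have := nbr_closed aF bW eab; rewrite in_setU (negPf bN) orbF.
have := nbr_closed bF aW; rewrite e_sym => /(_ eab).
by rewrite in_setU (negPf aN) orbF.
Qed.

Lemma kconn_connectivity k W :
  irreflexive e -> W != set0 -> (forall x, x \in W -> k <= deg_in W x) ->
  kconn k W -> k <= connectivity e W.
Proof.
move=> e_irr /set0Pn[w wW] dW kW; apply/leq_bigminP; split.
  apply: leq_trans (dW _ wW) (subset_leq_card _).
  by apply/subsetP => y; rewrite inE => /andP[].
(* If only [x] survives, all its neighbours lie in [S]; otherwise the component of [x] has its
   boundary in [S]. *)
move=> S /andP[SW] /orP[|/cards1P[x WSx]]; last first.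
  have xW : x \in W by have := set11 x; rewrite -WSx => /setDP[].
  apply: leq_trans (dW x xW) (subset_leq_card _); apply/subsetP => y.
  rewrite inE => /andP[yW exy]; apply: contraT => yS.
  have : y \in W :\: S by rewrite in_setD yS.
  by rewrite WSx => /set1P yx; rewrite yx e_irr in exy.
move=> /existsP[x /andP[xW' /existsP[z /andP[zW' ncxz]]]].
set F := [set y in W :\: S | connect (induced e (W :\: S)) x y].
have NS : boundary W F \subset S.
  apply/subsetP => y /boundaryP[yW yF [a]].
  rewrite inE => /andP[aW' cxa] eay.
  apply: contraNT yF => yS; have yW' : y \in W :\: S by rewrite in_setD yS.
  rewrite inE yW'; apply: connect_trans cxa (connect1 _).
  by apply/and3P.
apply: leq_trans (kW F _) (subset_leq_card NS).
apply/isolatedP; split.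
- by apply/subsetP => y; rewrite inE => /andP[/setDP[]].
- by exists x; rewrite inE xW' connect0.
exists z; apply/restP; split; first by case/setDP: zW'.
- by rewrite inE zW'.
by apply/negP => /(subsetP NS); case/setDP: zW' => _ /negP.
Qed.

(** * Uncrossing *)

Lemma boundaryIU W A B :
  #|boundary W (A :&: B)| + #|boundary W (A :|: B)| <=
  #|boundary W A| + #|boundary W B|.
Proof.
rewrite -cardsUI -[leqRHS]cardsUI; apply: leq_add; apply: subset_leq_card.
  apply/subsetP => y /setUP[] /boundaryP[yW yAB [x xAB exy]].
    move: xAB yAB; rewrite !in_setI negb_and in_setU => /andP[xA xB].
    by case/orP => yN; apply/orP; [left|right];
      apply/boundaryP; split=> //; exists x.
  move: xAB yAB; rewrite !in_setU negb_or => xAB /andP[yA yB].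
  by case/orP: xAB => xN; apply/orP; [left|right];
    apply/boundaryP; split=> //; exists x.
apply/subsetP => y /setIP[/boundaryP[yW _ [x /setIP[xA xB] exy]] /boundaryP[_]].
rewrite in_setU negb_or => /andP[yA yB] _.
by apply/setIP; split; apply/boundaryP; split=> //; exists x.
Qed.

(** A vertex in both rests keeps the union isolated too, so both boundaries have size at least [k],
    while submodularity bounds their sum by [2k]. *)
Lemma fragmentI k W A B :
  kconn k W -> fragment k W A -> fragment k W B ->
  A :&: B != set0 -> rest W A :&: rest W B != set0 -> fragment k W (A :&: B).
Proof.
move=> kW /andP[/isolatedP[AW _ _] NA] /andP[/isolatedP[BW _ _] NB].
move=> /set0Pn[x xAB] /set0Pn[z /setIP[/restP[zW zA zNA] /restP[_ zB zNB]]].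
have noadj a : a \in A :|: B -> e a z -> False.
  by case/setUP => [aA|aB] eaz; [case/negP: zNA|case/negP: zNB];
    apply/boundaryP; split=> //; exists a.
have isoI : isolated W (A :&: B).
  apply/isolatedP; split; [by rewrite subIset ?AW | by exists x | exists z].
  apply/restP; split=> //; first by rewrite in_setI (negPf zA).
  apply/negP => /boundaryP[_ _ [a /setIP[aA _]]]; apply: noadj.
  by rewrite in_setU aA.
have isoU : isolated W (A :|: B).
  apply/isolatedP; split; [by rewrite subUset AW | | exists z].
    by exists x; case/setIP: xAB => xA _; rewrite in_setU xA.
  apply/restP; split=> //; first by rewrite in_setU negb_or zA.
  by apply/negP => /boundaryP[_ _ [a]]; apply: noadj.
have := boundaryIU W A B; have := kW _ isoI; have := kW _ isoU.
by rewrite /fragment isoI /=; lia.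
Qed.

Lemma sub_boundary W A B :
  A \subset W -> A :&: B = set0 -> A :&: rest W B = set0 ->
  A \subset boundary W B.
Proof.
move=> AW AB AR; apply/subsetP => x xA; apply: contraT => xN.
have xB : x \notin B.
  by apply/negP => xB; have := in_set0 x; rewrite -AB in_setI xA xB.
have xR : x \in rest W B by apply/restP; split=> //; apply: (subsetP AW).
by have := in_set0 x; rewrite -AR in_setI xA xR.
Qed.

(** * Deleting and restoring vertices *)

Lemma isolated_setD1 W F x :
  isolated (W :\ x) F ->
  [/\ x \notin F, isolated W F & boundary W F \subset x |: boundary (W :\ x) F].
Proof.
move=> /isolatedP[FW F0 [z /restP[/setD1P[zx zW] zF zN]]].
have xF : x \notin F by apply/negP => /(subsetP FW); rewrite !inE eqxx.
have N : boundary W F \subset x |: boundary (W :\ x) F.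
  apply/subsetP => y /boundaryP[yW yF yx]; rewrite in_setU1.
  by case: eqVneq => //= nyx; apply/boundaryP; rewrite in_setD1 nyx.
split=> //; apply/isolatedP; split=> //.
  exact: subset_trans FW (subsetDl _ _).
exists z; apply/restP; split=> //; apply: contra zN => /(subsetP N).
by rewrite in_setU1 (negPf zx).
Qed.

Lemma fragment_setD1 k W F x :
  isolated (W :\ x) F -> #|boundary (W :\ x) F| < k -> fragment k W F.
Proof.
move=> /isolated_setD1[_ iW N] Nk; rewrite /fragment iW.
apply: leq_trans (subset_leq_card N) _.
by apply: leq_trans (leq_card_setU _ _) _; rewrite cards1.
Qed.

Lemma kconn_setD1 k W x :
  (forall F, ~~ fragment k W F) -> kconn k (W :\ x).
Proof.
move=> nf F iF; rewrite leqNgt; apply: contra (nf F).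
exact: fragment_setD1.
Qed.

(** A separation of [W'] either restricts to one of [W], or one of its sides has only new vertices;
    the neighbours in [W] of such a vertex then all lie in the boundary. *)
Lemma kconn_super k W W' :
  W \subset W' -> (forall x, x \in W' :\: W -> k <= deg_in W x) ->
  kconn k W -> kconn k W'.
Proof.
move=> WW' dW kW F /isolatedP[FW' [x xF] [z /restP[zW' zF zN]]].
have N : boundary W (F :&: W) \subset boundary W' F.
  apply/subsetP => y /boundaryP[yW]; rewrite in_setI yW andbT => yF.
  move=> [a /setIP[aF _] eay]; apply/boundaryP; split=> //.
    exact: (subsetP WW').
  by exists a.
have [FW0|] := eqVneq (F :&: W) set0.
  have xW : x \notin W.
    by apply/negP => xW; have := in_set0 x; rewrite -FW0 in_setI xF xW.
  apply: leq_trans (dW x _) (subset_leq_card _).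
    by rewrite in_setD xW (subsetP FW').
  apply/subsetP => y; rewrite inE => /andP[yW exy]; apply/boundaryP; split.
  - exact: (subsetP WW').
  - by apply/negP => yF; have := in_set0 y; rewrite -FW0 in_setI yF yW.
  - by exists x.
move=> /set0Pn FW0; have [R0|/set0Pn R0] := eqVneq (rest W (F :&: W)) set0.
  have zNW y : y \in W -> y \notin F -> y \in boundary W (F :&: W).
    move=> yW yF; apply: contraT => yN; rewrite -(in_set0 y) -R0.
    by apply/restP; rewrite in_setI (negPf yF).
  have zW : z \notin W.
    by apply: contra zN => zW; apply: (subsetP N); apply: zNW.
  apply: leq_trans (dW z _) _; first by rewrite in_setD zW.
  apply: leq_trans (subset_leq_card N); apply: subset_leq_card.
  apply/subsetP => y; rewrite inE => /andP[yW ezy]; apply: zNW => //.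
  apply: contra zN => yF; apply/boundaryP; split=> //.
  by exists y; rewrite // e_sym.
apply: leq_trans (kW _ _) (subset_leq_card N).
by apply/isolatedP; split=> //; apply: subsetIr.
Qed.

(** * Triangle-free graphs *)

Section TriangleFree.
Hypothesis e_tri : forall x y z, e x y -> e y z -> ~~ e x z.

Lemma inner_neighbour W F x :
  x \in F -> #|boundary W F| < deg_in W x -> exists2 y, y \in F & e x y.
Proof.
move=> xF; rewrite ltnNge => Nd.
have /subsetPn[y] : ~~ ([set y in W | e x y] \subset boundary W F).
  by apply: contra Nd; apply: subset_leq_card.
rewrite inE => /andP[yW exy] yN; exists y => //.
by have := nbr_closed xF yW exy; rewrite in_setU (negPf yN) orbF.
Qed.

(* The neighbourhoods of two adjacent vertices of F are disjoint and both lie *)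
(* in F together with its boundary.                                           *)
Lemma fragment_large k W F :
  (forall x, x \in W -> k < deg_in W x) -> fragment k W F -> k < #|F|.
Proof.
move=> dW /andP[/isolatedP[FW [x xF] _] Nk].
have dF a : a \in F -> k < deg_in W a by move=> aF; apply/dW/(subsetP FW).
have [y yF exy] := inner_neighbour xF (leq_ltn_trans Nk (dF x xF)).
have disj : [set z in W | e x z] :&: [set z in W | e y z] = set0.
  apply/setP => z; rewrite !inE; apply/negP => /andP[/andP[_ exz] /andP[_ eyz]].
  by case/negP: (e_tri exy eyz).
have sub a : a \in F -> [set z in W | e a z] \subset F :|: boundary W F.
  move=> aF; apply/subsetP => z; rewrite inE => /andP[zW eaz].
  exact: nbr_closed eaz.
have : [set z in W | e x z] :|: [set z in W | e y z] \subset F :|: boundary W F.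
  by rewrite subUset !sub.
move=> /subset_leq_card; rewrite cardsU disj cards0 subn0.
have := (leq_card_setU F (boundary W F)).1.
by have := dF x xF; have := dF y yF; rewrite /deg_in; lia.
Qed.

(* A k-separator meeting a minimal fragment F would cross it, and since no    *)
(* fragment fits inside a k-separator, two opposite corners of the crossing   *)
(* are nonempty; the one inside F contradicts minimality.                     *)
Lemma kconn_minimal_fragment k W F x :
  (forall x, x \in W -> k < deg_in W x) -> kconn k W -> fragment k W F ->
  (forall F', F' \proper F -> ~~ fragment k W F') -> x \in F ->
  kconn k (W :\ x).
Proof.
move=> dW kW fF minF xF B iB; rewrite leqNgt; apply/negP => NB.
have fB := fragment_setD1 iB NB.
have [xB iWB sN] := isolated_setD1 iB.
(* Otherwise restoring [x] would leave the boundary of [B] below [k]. *)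
have xN : x \in boundary W B.
  apply: contraT => xN; have := kW _ iWB; rewrite leqNgt => /negP[].
  apply: leq_ltn_trans NB; apply: subset_leq_card; apply/subsetP => y yN.
  have := subsetP sN _ yN; rewrite in_setU1 => /predU1P[yx|//].
  by rewrite -yx yN in xN.
have noI C : fragment k W C -> x \notin C ->
    (F :&: C == set0) || (rest W F :&: rest W C == set0).
  move=> fC xC; apply: contraT; rewrite negb_or => /andP[FC RC].
  have /negP[] : ~~ fragment k W (F :&: C).
    apply: minF; rewrite properE subsetIl; apply/subsetPn; exists x => //.
    by rewrite in_setI (negPf xC) andbF.
  exact: fragmentI.
have noS C D : fragment k W C -> fragment k W D ->
    (C :&: D == set0) && (C :&: rest W D == set0) = false.
  move=> fC /andP[_ ND]; apply/negP => /andP[/eqP CD /eqP CR].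
  have CW : C \subset W by case/andP: fC => /isolatedP[].
  have := subset_leq_card (sub_boundary CW CD CR).
  by have := fragment_large dW fC; lia.
have fRF := fragment_rest fF; have fRB := fragment_rest fB.
have xR : x \notin rest W B by apply/negP => /restP[_ _]; rewrite xN.
have BRR : (rest W F :&: rest W (rest W B) == set0) -> rest W F :&: B == set0.
  rewrite -!subset0; apply: subset_trans; apply: setIS; apply: sub_rest_rest.
  by case/isolatedP: iWB.
have := noI _ fRB xR; have := noI _ fB xB.
have := noS _ _ fF fB; have := noS _ _ fRF fB.
have := noS _ _ fB fF; have := noS _ _ fRB fF.
rewrite ![_ :&: F]setIC (setIC B) (setIC (rest W B)).
(* By [noI] each diagonal of the two-by-two crossing has an empty corner; two such corners share a
   row or a column, which [noS] forbids. *)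
move: BRR; case: (F :&: B == set0); case: (F :&: rest W B == set0);
  case: (rest W F :&: B == set0); case: (rest W F :&: rest W B == set0);
  by case: (rest W F :&: rest W (rest W B) == set0) => //= /(_ isT).
Qed.

(** Of two consecutive vertices at most one is adjacent to [x], so the path is consumed in pairs. *)
Lemma count_nbrs x p : sorted e p -> count (e x) p <= uphalf (size p).
Proof.
have [n] := ubnP (size p); elim: n => // n IH in p *.
case: p => [|a [|b p]] //= np; first by case: (e x a).
move=> /andP[eab pth].
have /IH : size p < n by lia.
move=> /(_ (path_sorted pth)) cp; rewrite addnA -add1n.
apply: leq_add cp.
case exa : (e x a) => //=; last by case: (e x b).
by rewrite (negPf (e_tri exa eab)).
Qed.

Lemma degree_path x p :
  sorted e p -> degree e x <= deg_in (~: [set z in p]) x + uphalf (size p).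
Proof.
move=> /(count_nbrs x); rewrite -size_filter => cp.
have : [set y | e x y] \subset
    [set y in ~: [set z in p] | e x y] :|: [set y in [seq z <- p | e x z]].
  apply/subsetP => y; rewrite !inE mem_filter => ->.
  by case: (y \in p).
move=> /subset_leq_card /leq_trans; apply.
apply: leq_trans (leq_card_setU _ _) _; rewrite leq_add2l.
by apply: leq_trans cp; rewrite cardsE card_size.
Qed.

(** * Growing the path *)

Section Extension.
Variables k m : nat.
Hypothesis e_deg : forall x, k + uphalf m.+1 <= degree e x.

(* Paths grow at the head of the sequence, so truncation drops a prefix.      *)
Definition off p := ~: [set z in p].

Definition keeping p := graph_path e p /\ kconn k (off p).

Lemma off_cons x p : off (x :: p) = off p :\ x.
Proof. by apply/setP => y; rewrite !inE negb_or. Qed.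

Lemma deg_off x p : graph_path e p -> size p < m -> k < deg_in (off p) x.
Proof.
move=> /andP[_ /(degree_path x)] dp pm.
(* As [uphalf m.+1] is [m./2 + 1], one neighbour beyond [k] is left over. *)
have : uphalf (size p) <= m./2 by rewrite uphalfE half_leq.
by have := e_deg x; rewrite uphalfE /= -/(off p) in dp *; lia.
Qed.

Lemma deg_off_last x p : graph_path e p -> size p = m -> k <= deg_in (off p) x.
Proof.
move=> /andP[_ /(degree_path x)] dp pm.
have : uphalf m <= uphalf m.+1 by rewrite !uphalfE half_leq.
by have := e_deg x; rewrite pm -/(off p) in dp *; lia.
Qed.

Lemma keeping_behead x p : size (x :: p) < m -> keeping (x :: p) -> keeping p.
Proof.
move=> pm [gxp kp]; have /andP[/= /andP[_ up] pth] := gxp.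
split; first by rewrite /graph_path up (path_sorted pth).
apply: kconn_super kp => [|y _]; first by rewrite off_cons subsetDl.
exact/ltnW/deg_off.
Qed.

Definition extends p x := if p is y :: _ then e y x else true.

Definition meets_end p F := [exists x in F, extends p x].

(** Restoring an end not adjacent to [F] leaves the boundary of [F] unchanged; the process stops at
    the latest at the empty path, which any vertex extends. *)
Lemma truncate_to_fragment p F :
  keeping p -> size p < m -> fragment k (off p) F ->
  exists q, [/\ keeping q, size q < m, fragment k (off q) F & meets_end q F].
Proof.
elim: p => [|y p IH] kp pm fF.
  exists [::]; split=> //; case/andP: fF => /isolatedP[_ [x xF] _] _.
  by apply/existsP; exists x; rewrite xF.
have [mF|nF] := boolP (meets_end (y :: p) F); first by exists (y :: p).
apply: IH (ltnW pm) _; first exact: keeping_behead kp.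
move: fF; rewrite off_cons => /andP[iF NF].
have [_ iF' sN] := isolated_setD1 iF; rewrite /fragment iF' /=.
apply: leq_trans NF; apply: subset_leq_card; apply/subsetP => z zN.
have := subsetP sN z zN; rewrite in_setU1 => /predU1P[zy|//].
case/boundaryP: zN => _ _ [x xF exz]; case/existsP: nF; exists x.
by rewrite xF /= e_sym -zy.
Qed.

Lemma graph_path_cons x p :
  graph_path e p -> x \in off p -> extends p x ->
  graph_path e (x :: p).
Proof.
move=> /andP[up sp]; rewrite in_setC inE => xp adj.
rewrite /graph_path /= xp up /=; case: p adj sp {up xp} => //= y p.
by rewrite e_sym => ->.
Qed.

Definition has_keeping_path := exists p, keeping p /\ size p = m.

Lemma fragment_extends p F :
  keeping p -> size p < m -> fragment k (off p) F -> meets_end p F ->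
  has_keeping_path.
Proof.
have [n] := ubnP #|F|; elim: n => // n IH in p F *.
move=> Fn [gp kp] pm fF mF.
have [/existsP[F' /andP[F'F /truncate_to_fragment fF']]|/existsPn minF] :=
  boolP [exists F' : {set T}, (F' \proper F) && fragment k (off p) F'].
  have [q [kq qm fq mq]] := fF' (conj gp kp) pm.
  apply: IH kq qm fq mq; apply: leq_trans (proper_card F'F) _; lia.
have dp y := deg_off y gp pm.
case/andP: (fF) => /isolatedP[FW _ [z /restP[zp zF zN]]] NF.
have /existsP[x /andP[xF adj]] := mF.
have xp := subsetP FW x xF.
have gxp := graph_path_cons gp xp adj.
have kxp : keeping (x :: p).
  split=> //; rewrite off_cons; apply: kconn_minimal_fragment fF _ xF => //.
  by move=> F' F'F; have := minF F'; rewrite F'F.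
have [pm'|] := ltnP (size (x :: p)) m; last first.
  move=> pm'; exists (x :: p); split=> //.
  by apply/eqP; rewrite eqn_leq pm' andbT.
(* The vertex [y] keeps [F :\ x] nonempty and adjacent to the new end [x]. *)
have [y yF exy] := inner_neighbour xF (leq_ltn_trans NF (dp x)).
have yx : y != x.
  apply: contraTneq exy => ->; apply/negP => exx.
  by have := e_tri exx exx; rewrite exx.
have yFx : y \in F :\ x by rewrite in_setD1 yx.
have sN : boundary (off p :\ x) (F :\ x) \subset boundary (off p) F.
  apply/subsetP => w /boundaryP[/setD1P[wx wp] wF [a /setD1P[_ aF] eaw]].
  apply/boundaryP; split=> //; last by exists a.
  by move: wF; rewrite in_setD1 wx.
apply: (IH (x :: p) (F :\ x)) => //.
- by move: Fn; rewrite (cardsD1 x) xF.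
- rewrite off_cons; apply/andP; split.
    2: exact: leq_trans (subset_leq_card sN) NF.
  apply/isolatedP; split; [exact: setSD | by exists y | exists z].
  apply/restP; split.
  + by rewrite in_setD1 zp andbT; apply: contraNneq zF => ->.
  + by rewrite in_setD1 (negPf zF) andbF.
  + by apply: contra zN; apply: (subsetP sN).
- by apply/existsP; exists y; rewrite yFx.
Qed.

Lemma keeping_path (x0 : T) : kconn k setT -> has_keeping_path.
Proof.
move=> kT.
(* The first alternative records that a fragment has appeared: [fragment_extends] then reaches
   length [m] at once. *)
suff [//|[p kp]] : has_keeping_path \/ exists p, keeping p /\ size p = m.
  by exists p.
elim: {1 3}m (leqnn m) => [|n IH] nm.
  right; exists [::]; split=> //; split=> //.
  by have -> : off [::] = setT by apply/setP => y; rewrite !inE.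
have [|[p [kp pn]]] := IH (ltnW nm); first by left.
have pm : size p < m by rewrite pn.
have [/existsP[F /(truncate_to_fragment kp pm)
      [q [kq qm fq mq]]]|/existsPn nF] :=
  boolP [exists F : {set T}, fragment k (off p) F].
  by left; apply: fragment_extends kq qm fq mq.
right; case: (kp) => gp kkp.
have [x xp adj] : exists2 x, x \in off p & extends p x.
  case: p gp pm {kp pn nF kkp} => [|y p] gp pm.
    by exists x0; rewrite ?inE.
  have : 0 < deg_in (off (y :: p)) y by apply: leq_ltn_trans (deg_off y gp pm).
  by move=> /card_gt0P[x]; rewrite inE => /andP[xp exy]; exists x.
exists (x :: p); rewrite /= pn; split=> //.
split; first exact: graph_path_cons adj.
by rewrite off_cons; apply: kconn_setD1.
Qed.

End Extension.
End TriangleFree.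
End Fragments.

(* [uphalf n] is n / 2 rounded up. *)
Theorem theorem3p2 (T : finType) (e : rel T) (k m : nat)
    (e_sym : symmetric e) (e_irr : irreflexive e)
    (k_gt0 : 0 < k) (m_gt0 : 0 < m)
    (e_conn : k_connected e k) (e_bip : bipartite e)
    (e_deg : k + uphalf m.+1 <= min_degree e) :
  exists p : seq T,
    [/\ graph_path e p, size p = m
      & k <= connectivity e (~: [set x in p])].
Proof.
have [A eA] := e_bip.
have e_tri x y z : e x y -> e y z -> ~~ e x z.
  move=> /eA xy /eA yz; apply/negP => /eA; move: xy yz.
  by case: (x \in A); case: (y \in A); case: (z \in A).
have /leq_bigminP[kT dT] := e_deg.
have /card_gt0P[x0 _] : 0 < #|T| by apply: leq_trans kT; rewrite addn_gt0 k_gt0.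
have [p [[gp kp] pm]] :=
  keeping_path e_sym e_tri (fun x => dT x isT) x0
    (connectivity_kconn e_sym e_conn).
exists p; split=> //.
(* At length [m] the degree bound drops to [k], just enough to recover connectivity from [kconn]. *)
have dp x := deg_off_last e_tri (fun x => dT x isT) x gp pm.
apply: kconn_connectivity => //.
have /card_gt0P[x] := leq_trans k_gt0 (dp x0).
by rewrite inE => /andP[xp _]; apply/set0Pn; exists x.
Qed.
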